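(* (i) If $V$ and $W$ are Boolean algebras, then $V\otimes W$ with the componentwise structure is a Boolean algebra. (ii) For every finite set $x$, the Boolean algebra $\langle P(x)\rangle$ is isomorphic to $\langle P[1]\rangle^{\otimes |x|}$ (with the componentwise Boolean algebra structure).
   Context: $\mathbb{K}$ is a field of characteristic zero; $[n]=\{1,\dots,n\}$. For a vector space $V$, $S:V\otimes V\to V\otimes V$ is $S(u\otimes v)=v\otimes u$ and $I$ is the identity. A Boolean algebra is a $\mathbb{K}$-vector space $V$ with linear maps $\cup,\cap:V\otimes V\to V$, $c:V\to V$, $T,E:\mathbb{K}\to V$, $\triangle:V\to V\otimes V$, $ev:V\to\mathbb{K}$, satisfying (identifying $V\otimes\mathbb{K}\cong V$): (1) $\cup=\cup\circ S$, $\cap=\cap\circ S$; (2) $\cup\circ(\cup\otimes I)=\cup\circ(I\otimes\cup)$, $\cap\circ(\cap\otimes I)=\cap\circ(I\otimes\cap)$; (3) $\cap\circ(I\otimes\cup)=\cup\circ(\cap\otimes\cap)\circ(I\otimes S\otimes I)\circ(\triangle\otimes I\otimes I)$ and $\cup\circ(I\otimes\cap)=\cap\circ(\cup\otimes\cup)\circ(I\otimes S\otimes I)\circ(\triangle\otimes I\otimes I)$; (4) $\cup\circ(I\otimes E)=I$, $\cap\circ(I\otimes T)=I$; (5) $\cap\circ(I\otimes c)\circ\triangle=E\circ ev$, $\cup\circ(I\otimes c)\circ\triangle=T\circ ev$; (6) $\cap\circ(I\otimes\cup)\circ(\triangle\otimes I)=I\otimes ev$, $\cup\circ(I\otimes\cap)\circ(\triangle\otimes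 I)=I\otimes ev$; (7) $(\triangle\otimes I)\circ\triangle=(I\otimes\triangle)\circ\triangle$; (8) $S\circ\triangle=\triangle$. The componentwise structure on $V\otimes W$: $\cup_{V\otimes W}=(\cup_V\otimes\cup_W)\circ(I\otimes S_{W,V}\otimes I)$ (where $S_{W,V}:W\otimes V\to V\otimes W$ is the flip), similarly for $\cap$; $c=c_V\otimes c_W$; $\triangle=(I\otimes S_{V,W}\otimes I)\circ(\triangle_V\otimes\triangle_W)$; $ev=ev_V\otimes ev_W$; $T(s)=s\,T_V(1)\otimes T_W(1)$, $E(s)=s\,E_V(1)\otimes E_W(1)$. For a set $x$, $\langle P(x)\rangle$ is the vector space with basis the subsets of $x$, with Boolean algebra structure: $\cup,\cap$ the bilinear extensions of set union and intersection, $c(a)=x\setminus a$, $\triangle(a)=a\otimes a$, $ev(a)=1$ for subsets $a$, $E(s)=s\emptyset$, $T(s)=sx$. $P[1]=P(\{1\})$. *)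

(* Defs.v *)
From HB Require Import structures.
From mathcomp Require Import all_boot all_algebra boolp.

Set Implicit Arguments.
Unset Strict Implicit.
Unset Printing Implicit Defensive.

Import GRing.Theory.
Local Open Scope ring_scope.
Local Open Scope quotient_scope.

(* The tensor product of two arbitrary (possibly infinite-dimensional) vector
   spaces: formal sums of pairs modulo the bilinearity relations.  The formal
   multiple a (v, w) is represented by (a *: v, w), whence the absence of
   coefficients and the relation (0, w) ~ 0. *)
Section TensorProduct.
Variables (K : fieldType) (V W : lmodType K).

Inductive tensor_eq : seq (V * W) -> seq (V * W) -> Prop :=
| tensor_eq_refl s : tensor_eq s s
| tensor_eq_sym s t : tensor_eq s t -> tensor_eq t s
| tensor_eq_trans s t u : tensor_eq s t -> tensor_eq t u -> tensor_eq s u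
| tensor_eq_cat s s' t t' :
    tensor_eq s s' -> tensor_eq t t' -> tensor_eq (s ++ t) (s' ++ t')
| tensor_eq_catC s t : tensor_eq (s ++ t) (t ++ s)
| tensor_eq_addl v v' w : tensor_eq [:: (v + v', w)] [:: (v, w); (v', w)]
| tensor_eq_addr v w w' : tensor_eq [:: (v, w + w')] [:: (v, w); (v, w')]
| tensor_eq_scale a v w : tensor_eq [:: (a *: v, w)] [:: (v, a *: w)]
| tensor_eq_0 w : tensor_eq [:: (0, w)] [::].

Definition tensor_rel (s t : seq (V * W)) : bool := `[< tensor_eq s t >].

Fact tensor_rel_refl : reflexive tensor_rel.
Proof. by move=> s; apply/asboolP; constructor. Qed.

Fact tensor_rel_sym : symmetric tensor_rel.
Proof.
by move=> s t; apply/asboolP/asboolP => ?; apply: tensor_eq_sym.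
Qed.

Fact tensor_rel_trans : transitive tensor_rel.
Proof.
move=> t s u /asboolP st /asboolP tu; apply/asboolP.
exact: tensor_eq_trans st tu.
Qed.

Canonical tensor_equiv :=
  EquivRel tensor_rel tensor_rel_refl tensor_rel_sym tensor_rel_trans.

Definition tensor := {eq_quot tensor_equiv}.
HB.instance Definition _ := Choice.on tensor.
HB.instance Definition _ := EqQuotient.on tensor.

Let cls (s : seq (V * W)) : tensor := \pi_tensor s.

Let clsP s t : tensor_eq s t -> cls s = cls t.
Proof. by move=> st; rewrite /cls; apply/eqmodP; apply/asboolP. Qed.

Let reprP s : tensor_eq (repr (cls s)) s.
Proof. apply/asboolP; apply/(@eqquotP _ _ tensor); exact: reprK. Qed.

Let clsW (P : tensor -> Prop) : (forall s, P (cls s)) -> forall t, P t.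
Proof. by move=> Pcls t; rewrite -[t]reprK. Qed.

Let scales (a : K) (s : seq (V * W)) := [seq (a *: p.1, p.2) | p <- s].

Let scales_eq a s t : tensor_eq s t -> tensor_eq (scales a s) (scales a t).
Proof.
elim=> {s t}.
- by constructor.
- by move=> *; apply: tensor_eq_sym.
- by move=> s t u _ IH1 _ IH2; apply: tensor_eq_trans IH1 IH2.
- by move=> *; rewrite /scales !map_cat; apply: tensor_eq_cat.
- by move=> s t; rewrite /scales !map_cat; apply: tensor_eq_catC.
- by move=> v v' w; rewrite /= scalerDr; apply: tensor_eq_addl.
- by move=> v w w'; apply: tensor_eq_addr.
- move=> b v w /=; rewrite scalerA mulrC -scalerA; exact: tensor_eq_scale.
- by move=> w; rewrite /= scaler0; apply: tensor_eq_0.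
Qed.

Definition tensor_zero : tensor := \pi_tensor [::].
Definition tensor_add (x y : tensor) : tensor := \pi_tensor (repr x ++ repr y).
Definition tensor_scale (a : K) (x : tensor) : tensor :=
  \pi_tensor [seq (a *: p.1, p.2) | p <- repr x].
Definition tensor_opp (x : tensor) : tensor := tensor_scale (-1) x.

Let addE s t : tensor_add (cls s) (cls t) = cls (s ++ t).
Proof. by apply: clsP; apply: tensor_eq_cat; apply: reprP. Qed.

Let scaleE a s : tensor_scale a (cls s) = cls (scales a s).
Proof. by apply: clsP; apply: scales_eq; apply: reprP. Qed.

Fact tensor_addA : associative tensor_add.
Proof.
by elim/clsW=> s; elim/clsW=> t; elim/clsW=> u; rewrite !addE catA.
Qed.

Fact tensor_addC : commutative tensor_add.
Proof.
by elim/clsW=> s; elim/clsW=> t; rewrite !addE; apply: clsP; constructor.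
Qed.

Fact tensor_add0 : left_id tensor_zero tensor_add.
Proof. by elim/clsW=> s; rewrite -[tensor_zero]/(cls [::]) addE. Qed.

Let clsS p s : cls (p :: s) = tensor_add (cls [:: p]) (cls s).
Proof. by rewrite addE. Qed.

Fact tensor_scaleDl s a b :
  tensor_scale (a + b) s = tensor_add (tensor_scale a s) (tensor_scale b s).
Proof.
elim/clsW: s => s; rewrite !scaleE; elim: s => [|[v w] s IHs].
  by rewrite addE.
rewrite /scales !map_cons clsS [cls (scales _ _)]IHs /=.
rewrite [cls ((_, w) :: map _ s)]clsS [X in _ = tensor_add _ X]clsS.
have ->: cls [:: ((a + b) *: v, w)]
    = tensor_add (cls [:: (a *: v, w)]) (cls [:: (b *: v, w)]).
  by rewrite addE scalerDl; apply: clsP; apply: tensor_eq_addl.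
rewrite -!tensor_addA; congr tensor_add.
by rewrite !tensor_addA; congr tensor_add; rewrite tensor_addC.
Qed.

Let scale0 s : tensor_scale 0 s = tensor_zero.
Proof.
elim/clsW: s => s; rewrite scaleE; elim: s => [|[v w] s IHs] //.
rewrite /scales map_cons clsS [cls (scales _ _)]IHs /= scale0r.
rewrite (clsP (tensor_eq_0 w)); exact: tensor_add0.
Qed.

Fact tensor_scale1 : left_id 1 tensor_scale.
Proof.
elim/clsW=> s; rewrite scaleE; congr cls.
by rewrite -[RHS]map_id; apply: eq_map => -[v w]; rewrite /= scale1r.
Qed.

Fact tensor_addN : left_inverse tensor_zero tensor_opp tensor_add.
Proof.
by move=> s; rewrite -{2}[s]tensor_scale1 -tensor_scaleDl addNr scale0.
Qed.

Fact tensor_scaleA a b s :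
  tensor_scale a (tensor_scale b s) = tensor_scale (a * b) s.
Proof.
elim/clsW: s => s; rewrite !scaleE; congr cls.
by rewrite /scales -map_comp; apply: eq_map => p /=; rewrite scalerA.
Qed.

Fact tensor_scaleDr : right_distributive tensor_scale tensor_add.
Proof.
move=> a; elim/clsW=> s; elim/clsW=> t.
by rewrite !(scaleE, addE) /scales map_cat.
Qed.

HB.instance Definition _ := GRing.isZmodule.Build tensor
  tensor_addA tensor_addC tensor_add0 tensor_addN.
HB.instance Definition _ := GRing.Zmodule_isLmodule.Build K tensor
  tensor_scaleA tensor_scale1 tensor_scaleDr tensor_scaleDl.

Definition tens (v : V) (w : W) : tensor := \pi_tensor [:: (v, w)].

Lemma tensDl w : {morph tens^~ w : v v' / v + v'}.
Proof.
move=> v v'; rewrite -[RHS]/(tensor_add _ _) [RHS]addE.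
by apply: clsP; apply: tensor_eq_addl.
Qed.

Lemma tensDr v : {morph tens v : w w' / w + w'}.
Proof.
move=> w w'; rewrite -[RHS]/(tensor_add _ _) [RHS]addE.
by apply: clsP; apply: tensor_eq_addr.
Qed.

Lemma tensZl w a v : tens (a *: v) w = a *: tens v w.
Proof. by rewrite -[RHS]/(tensor_scale _ _) [RHS]scaleE. Qed.

Lemma tensZr v a w : tens v (a *: w) = a *: tens v w.
Proof.
by rewrite -tensZl; apply: clsP; apply: tensor_eq_sym; apply: tensor_eq_scale.
Qed.

Lemma tensor_sum (t : tensor) : t = \sum_(p <- repr t) tens p.1 p.2.
Proof.
rewrite -{1}[t]reprK; elim: (repr t) => [|[v w] s IHs].
  by rewrite big_nil.
by rewrite big_cons -IHs -[RHS]/(tensor_add _ _) [RHS]addE.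
Qed.

Lemma tensor_ind (P : tensor -> Prop) :
  P 0 -> (forall v w t, P t -> P (tens v w + t)) -> forall t, P t.
Proof.
move=> P0 PS t; rewrite [t]tensor_sum.
by elim: (repr t) => [|p s IHs]; rewrite ?big_nil // big_cons; apply: PS.
Qed.

Definition bilinear_map (U : lmodType K) (f : V -> W -> U) :=
  (forall w, linear (f^~ w)) /\ (forall v, linear (f v)).

Lemma tens_bilinear : bilinear_map tens.
Proof.
by split=> [w a v v'|v a w w']; rewrite ?tensDl ?tensDr ?tensZl ?tensZr.
Qed.

(* Meaningful only when f is bilinear. *)
Definition tlift (U : lmodType K) (f : V -> W -> U) (t : tensor) : U :=
  \sum_(p <- repr t) f p.1 p.2.

Section Lift.
Variables (U : lmodType K) (f : V -> W -> U).
Hypothesis bif : bilinear_map f.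

Let fDl w : {morph f^~ w : v v' / v + v'}.
Proof. by move=> v v'; have := bif.1 w 1 v v'; rewrite !scale1r. Qed.
Let fDr v : {morph f v : w w' / w + w'}.
Proof. by move=> w w'; have := bif.2 v 1 w w'; rewrite !scale1r. Qed.
Let f0l w : f 0 w = 0.
Proof. by apply: (addIr (f 0 w)); rewrite -fDl !add0r. Qed.
Let f0r v : f v 0 = 0.
Proof. by apply: (addIr (f v 0)); rewrite -fDr !add0r. Qed.
Let fZl w a v : f (a *: v) w = a *: f v w.
Proof. by have := bif.1 w a v 0; rewrite f0l !addr0. Qed.
Let fZr v a w : f v (a *: w) = a *: f v w.
Proof. by have := bif.2 v a w 0; rewrite f0r !addr0. Qed.

Let sum_eq s t : tensor_eq s t ->
  \sum_(p <- s) f p.1 p.2 = \sum_(p <- t) f p.1 p.2.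
Proof.
elim=> {s t} //.
- by move=> s t u _ -> _ ->.
- by move=> s s' t t' _ IH1 _ IH2; rewrite !big_cat /= IH1 IH2.
- by move=> s t; rewrite !big_cat /= addrC.
- by move=> v v' w; rewrite !(big_cons, big_nil) /= !addr0 fDl.
- by move=> v w w'; rewrite !(big_cons, big_nil) /= !addr0 fDr.
- by move=> a v w; rewrite !(big_cons, big_nil) /= !addr0 fZl fZr.
- by move=> w; rewrite !(big_cons, big_nil) /= f0l addr0.
Qed.

Let tlift_cls s : tlift f (cls s) = \sum_(p <- s) f p.1 p.2.
Proof. by apply: sum_eq; apply: reprP. Qed.

Lemma tlift_linear : linear (tlift f).
Proof.
move=> a; elim/clsW=> s; elim/clsW=> t.
rewrite -[a *: _]/(tensor_scale _ _) scaleE -[_ + _]/(tensor_add _ _) addE.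
rewrite !tlift_cls big_cat /= big_map scaler_sumr; congr (_ + _).
by apply: eq_bigr => p _; rewrite fZl.
Qed.

Lemma tliftE v w : tlift f (tens v w) = f v w.
Proof. by rewrite tlift_cls big_seq1. Qed.

End Lift.

Lemma tensor_ext (U : lmodType K) (f g : {linear tensor -> U}) :
  (forall v w, f (tens v w) = g (tens v w)) -> f =1 g.
Proof.
move=> fg; elim/tensor_ind => [|v w t IHt]; first by rewrite !linear0.
by rewrite !linearD fg IHt.
Qed.

Lemma tensor_universal (U : lmodType K) (f : V -> W -> U) :
  bilinear_map f ->
  exists2 g : {linear tensor -> U}, forall v w, g (tens v w) = f v w
    & forall h : {linear tensor -> U},
        (forall v w, h (tens v w) = f v w) -> h =1 g.
Proof.
move=> bif.
pose L := GRing.isLinear.Build K tensor U *:%R _ (tlift_linear bif).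
pose g : {linear tensor -> U} := HB.pack (tlift f) L.
have gE v w : g (tens v w) = f v w by exact: tliftE.
by exists g => // h hE; apply: tensor_ext => v w; rewrite gE hE.
Qed.

End TensorProduct.

Notation "V ⊗ W" := (tensor V%type W%type)
  (at level 40, left associativity) : type_scope.
Notation "v ⊗ w" := (tens v w)
  (at level 40, left associativity) : ring_scope.

Section TensorMaps.
Variable K : fieldType.
Implicit Types U V W X : lmodType K.

Lemma tmap_subproof V V' W W' (f : {linear V -> V'}) (g : {linear W -> W'}) :
  bilinear_map (fun v w => f v ⊗ g w).
Proof.
by split=> [w a v v'|v a w w']; rewrite linearP ?tensDl ?tensDr ?tensZl ?tensZr.
Qed.

Definition tmap V V' W W' (f : {linear V -> V'}) (g : {linear W -> W'}) :
    V ⊗ W -> V' ⊗ W' :=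
  tlift (fun v w => f v ⊗ g w).

HB.instance Definition _ V V' W W' (f : {linear V -> V'}) (g : {linear W -> W'})
  := GRing.isLinear.Build K _ _ *:%R (tmap f g)
       (tlift_linear (tmap_subproof f g)).

Lemma tmapE V V' W W' (f : {linear V -> V'}) (g : {linear W -> W'}) v w :
  tmap f g (v ⊗ w) = f v ⊗ g w.
Proof. exact: tliftE (tmap_subproof f g) _ _. Qed.

Lemma tswap_subproof V W : bilinear_map (fun (v : V) (w : W) => w ⊗ v).
Proof.
by split=> [w a v v'|v a w w']; rewrite ?tensDl ?tensDr ?tensZl ?tensZr.
Qed.

Definition tswap V W : V ⊗ W -> W ⊗ V := tlift (fun v w => w ⊗ v).

HB.instance Definition _ V W :=
  GRing.isLinear.Build K _ _ *:%R (@tswap V W)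
    (tlift_linear (@tswap_subproof V W)).

Lemma tswapE V W (v : V) (w : W) : tswap (v ⊗ w) = w ⊗ v.
Proof. exact: tliftE (@tswap_subproof V W) _ _. Qed.

Lemma runit_subproof V : bilinear_map (fun (v : V) (s : K^o) => s *: v).
Proof.
split=> [s a v v'|v a s s']; first by rewrite scalerDr !scalerA mulrC.
by rewrite scalerDl scalerA.
Qed.

(* The identification of V ⊗ K with V. *)
Definition runit V : V ⊗ K^o -> V := tlift (fun v (s : K^o) => s *: v).

HB.instance Definition _ V :=
  GRing.isLinear.Build K _ _ *:%R (@runit V) (tlift_linear (@runit_subproof V)).

Lemma runitE V (v : V) (s : K^o) : runit (v ⊗ s) = s *: v.
Proof. exact: tliftE (@runit_subproof V) _ _. Qed.

Lemma line_subproof V (v : V) : linear (fun s : K^o => s *: v).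
Proof. by move=> a s s'; rewrite scalerDl scalerA. Qed.

Definition line V (v : V) (s : K^o) : V := s *: v.

HB.instance Definition _ V (v : V) :=
  GRing.isLinear.Build K _ _ *:%R (line v) (line_subproof v).

Lemma tassoc_subproof1 U V W (w : W) :
  bilinear_map (fun (u : U) (v : V) => u ⊗ (v ⊗ w)).
Proof.
by split=> [v a u u'|u a v v'];
  rewrite ?(tensDl, tensDr) ?(tensZl, tensZr, tensDr).
Qed.

Lemma tassoc_subproof U V W :
  bilinear_map (fun t (w : W) => tlift (fun (u : U) (v : V) => u ⊗ (v ⊗ w)) t).
Proof.
split=> [w a t t'|t a w w']; 
  first exact: (tlift_linear (@tassoc_subproof1 U V W w)).
rewrite /tlift scaler_sumr -big_split; apply: eq_bigr => p _ /=.
by rewrite tensDr tensZr tensDr tensZr.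
Qed.

Definition tassoc U V W : (U ⊗ V) ⊗ W -> U ⊗ (V ⊗ W) :=
  tlift (fun t w => tlift (fun u v => u ⊗ (v ⊗ w)) t).

HB.instance Definition _ U V W :=
  GRing.isLinear.Build K _ _ *:%R (@tassoc U V W)
    (tlift_linear (@tassoc_subproof U V W)).

Lemma tassocE U V W (u : U) (v : V) (w : W) :
  tassoc ((u ⊗ v) ⊗ w) = u ⊗ (v ⊗ w).
Proof.
rewrite /tassoc (tliftE (@tassoc_subproof U V W)) /=.
by rewrite (tliftE (@tassoc_subproof1 U V W w)).
Qed.

Lemma tassocV_subproof1 U V W (u : U) :
  bilinear_map (fun (v : V) (w : W) => (u ⊗ v) ⊗ w).
Proof.
by split=> [w a v v'|v a w w'];
  rewrite ?(tensDl, tensDr) ?(tensZl, tensZr, tensDl).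
Qed.

Lemma tassocV_subproof U V W :
  bilinear_map (fun (u : U) t => tlift (fun (v : V) (w : W) => (u ⊗ v) ⊗ w) t).
Proof.
split=> [t a u u'|u a t t'];
  last exact: (tlift_linear (@tassocV_subproof1 U V W u)).
rewrite /tlift scaler_sumr -big_split; apply: eq_bigr => p _ /=.
by rewrite tensDl tensZl tensDl tensZl.
Qed.

Definition tassocV U V W : U ⊗ (V ⊗ W) -> (U ⊗ V) ⊗ W :=
  tlift (fun u t => tlift (fun v w => (u ⊗ v) ⊗ w) t).

HB.instance Definition _ U V W :=
  GRing.isLinear.Build K _ _ *:%R (@tassocV U V W)
    (tlift_linear (@tassocV_subproof U V W)).

Lemma tassocVE U V W (u : U) (v : V) (w : W) :
  tassocV (u ⊗ (v ⊗ w)) = (u ⊗ v) ⊗ w.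
Proof.
rewrite /tassocV (tliftE (@tassocV_subproof U V W)) /=.
by rewrite (tliftE (@tassocV_subproof1 U V W u)).
Qed.

(* I ⊗ S ⊗ I, with explicit associators. *)
Definition tmidswap U V W X : (U ⊗ V) ⊗ (W ⊗ X) -> (U ⊗ W) ⊗ (V ⊗ X) :=
  @tassocV U W (V ⊗ X)%type
  \o tmap idfun (@tassoc W V X \o tmap (@tswap V W) idfun \o @tassocV V W X)
  \o @tassoc U V (W ⊗ X)%type.

HB.instance Definition _ U V W X := GRing.Linear.copy (@tmidswap U V W X)
  (@tassocV U W (V ⊗ X)%type
   \o tmap idfun (@tassoc W V X \o tmap (@tswap V W) idfun \o @tassocV V W X)
   \o @tassoc U V (W ⊗ X)%type).

Lemma tmidswapE U V W X (u : U) (v : V) (w : W) (x : X) :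
  tmidswap ((u ⊗ v) ⊗ (w ⊗ x)) = (u ⊗ w) ⊗ (v ⊗ x).
Proof.
rewrite /tmidswap /= tassocE tmapE /= tassocVE tmapE /= tswapE.
by rewrite tassocE tassocVE.
Qed.

End TensorMaps.

Arguments tswap {K V W}.
Arguments runit {K V}.
Arguments tassoc {K U V W}.
Arguments tassocV {K U V W}.
Arguments tmidswap {K U V W X}.

Record boolStruct (K : fieldType) := BoolStruct {
  bcarrier :> lmodType K;
  bcup : {linear (bcarrier ⊗ bcarrier)%type -> bcarrier};
  bcap : {linear (bcarrier ⊗ bcarrier)%type -> bcarrier};
  bcompl : {linear bcarrier -> bcarrier};
  btop : {linear K^o -> bcarrier};
  bbot : {linear K^o -> bcarrier};
  bdiag : {linear bcarrier -> (bcarrier ⊗ bcarrier)%type};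
  bev : {linear bcarrier -> K^o} }.

Arguments bcup {K b}.
Arguments bcap {K b}.
Arguments bcompl {K b}.
Arguments btop {K b}.
Arguments bbot {K b}.
Arguments bdiag {K b}.
Arguments bev {K b}.

Record is_boolAlg (K : fieldType) (V : boolStruct K) : Prop := IsBoolAlg {
  bcupC : bcup =1 bcup \o @tswap K V V;
  bcapC : bcap =1 bcap \o @tswap K V V;
  bcupA : bcup \o tmap (@bcup K V) idfun =1 bcup \o tmap idfun bcup \o tassoc;
  bcapA : bcap \o tmap (@bcap K V) idfun =1 bcap \o tmap idfun bcap \o tassoc;
  bcapUr : bcap \o tmap idfun (@bcup K V)
    =1 bcup \o tmap bcap bcap \o tmidswap \o tmap bdiag idfun;
  bcupIr : bcup \o tmap idfun (@bcap K V)
    =1 bcap \o tmap bcup bcup \o tmidswap \o tmap bdiag idfun;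
  bcup0 : bcup \o tmap idfun (@bbot K V) =1 runit;
  bcap1 : bcap \o tmap idfun (@btop K V) =1 runit;
  bcapN : bcap \o tmap idfun bcompl \o bdiag =1 @bbot K V \o bev;
  bcupN : bcup \o tmap idfun bcompl \o bdiag =1 @btop K V \o bev;
  bcapUK : bcap \o tmap idfun (@bcup K V) \o tassoc \o tmap bdiag idfun
    =1 runit \o tmap idfun bev;
  bcupIK : bcup \o tmap idfun (@bcap K V) \o tassoc \o tmap bdiag idfun
    =1 runit \o tmap idfun bev;
  bdiagA : tassoc \o tmap (@bdiag K V) idfun \o bdiag
    =1 tmap idfun bdiag \o bdiag;
  bdiagC : tswap \o @bdiag K V =1 bdiag }.

Definition tensorBA (K : fieldType) (V W : boolStruct K) : boolStruct K := {|
  bcarrier := (V ⊗ W)%type;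
  bcup := tmap bcup bcup \o @tmidswap K V W V W;
  bcap := tmap bcap bcap \o @tmidswap K V W V W;
  bcompl := tmap bcompl bcompl;
  btop := line (@btop K V 1 ⊗ @btop K W 1);
  bbot := line (@bbot K V 1 ⊗ @bbot K W 1);
  bdiag := @tmidswap K V V W W \o tmap bdiag bdiag;
  bev := runit \o tmap (@bev K V) (@bev K W) |}.

(* The empty tensor product. *)
Definition unitBA (K : fieldType) : boolStruct K := {|
  bcarrier := K^o;
  bcup := runit;
  bcap := runit;
  bcompl := idfun;
  btop := idfun;
  bbot := idfun;
  bdiag := line ((1 : K^o) ⊗ (1 : K^o));
  bev := idfun |}.

Definition tpowBA (K : fieldType) (V : boolStruct K) (n : nat) : boolStruct K :=
  iterop n (@tensorBA K) V (unitBA K).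

Record is_boolMorph (K : fieldType) (V W : boolStruct K) (f : {linear V -> W})
    : Prop := IsBoolMorph {
  bmorph_cup : f \o bcup =1 bcup \o tmap f f;
  bmorph_cap : f \o bcap =1 bcap \o tmap f f;
  bmorph_compl : f \o bcompl =1 bcompl \o f;
  bmorph_top : f \o btop =1 btop;
  bmorph_bot : f \o bbot =1 bbot;
  bmorph_diag : tmap f f \o bdiag =1 bdiag \o f;
  bmorph_ev : bev =1 bev \o f }.

Definition boolIso (K : fieldType) (V W : boolStruct K) : Prop :=
  exists2 f : {linear V -> W}, bijective f & is_boolMorph f.

(* The vector space with basis a finite type B is realised as
   {ffun B -> K^o}, the basis vectors being the indicator functions. *)
Section FreeSpace.
Variables (K : fieldType) (B : finType).

Definition fbasis (b : B) : {ffun B -> K^o} := [ffun b' => (b' == b)%:R].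

Definition fext (U : lmodType K) (f : B -> U) (u : {ffun B -> K^o}) : U :=
  \sum_b u b *: f b.

Lemma fext_subproof U f : linear (@fext U f).
Proof.
move=> a u v; rewrite /fext scaler_sumr -big_split; apply: eq_bigr => b _ /=.
by rewrite !ffunE scalerDl scalerA.
Qed.

HB.instance Definition _ U f :=
  GRing.isLinear.Build K _ _ *:%R (@fext U f) (fext_subproof f).

Lemma fextE U f b : @fext U f (fbasis b) = f b.
Proof.
rewrite /fext (bigD1 b) //= big1 => [|b' /negPf bb'].
  by rewrite ffunE eqxx scale1r addr0.
by rewrite ffunE bb' scale0r.
Qed.

Lemma fbasis_sum (u : {ffun B -> K^o}) : u = \sum_b u b *: fbasis b.
Proof.
apply/ffunP => b; rewrite sum_ffunE (bigD1 b) //= big1 => [|b' /negPf bb'].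
  by rewrite !ffunE eqxx addr0 [RHS]mulr1.
by rewrite !ffunE eq_sym bb' [LHS]mulr0.
Qed.

Lemma fext2_subproof (U : lmodType K) (f : B -> B -> U) :
  bilinear_map (fun u v : {ffun B -> K^o} => fext (fun a => fext (f a) v) u).
Proof.
split=> [v a u u'|u a v v']; first exact: fext_subproof.
rewrite /fext scaler_sumr -big_split; apply: eq_bigr => b _ /=.
by rewrite -!/(fext _ _) linearP scalerDr !scalerA mulrC.
Qed.

Definition fext2 (U : lmodType K) (f : B -> B -> U) :
    {ffun B -> K^o} ⊗ {ffun B -> K^o} -> U :=
  tlift (fun u v => fext (fun a => fext (f a) v) u).

HB.instance Definition _ U f :=
  GRing.isLinear.Build K _ _ *:%R (@fext2 U f)
    (tlift_linear (fext2_subproof f)).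

Lemma fext2E U f a b : @fext2 U f (fbasis a ⊗ fbasis b) = f a b.
Proof. by rewrite /fext2 (tliftE (fext2_subproof f)) !fextE. Qed.

End FreeSpace.

Arguments fbasis K {B}.

(* The finite set x is the finite type X; its subsets are {set X}. *)
Definition powBA (K : fieldType) (X : finType) : boolStruct K := {|
  bcarrier := {ffun {set X} -> K^o};
  bcup := fext2 (fun a b => fbasis K (a :|: b));
  bcap := fext2 (fun a b => fbasis K (a :&: b));
  bcompl := fext (fun a => fbasis K (~: a));
  btop := line (fbasis K [set: X]);
  bbot := line (fbasis K set0);
  bdiag := fext (fun a => fbasis K a ⊗ fbasis K a);
  bev := fext (fun=> 1 : K^o) |}.

Section Spanning.
Variable K : fieldType.

Definition spanning (I : Type) (V : lmodType K) (e : I -> V) :=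
  forall (U : lmodType K) (f g : {linear V -> U}),
    (forall i, f (e i) = g (e i)) -> f =1 g.

Lemma fbasis_spanning (B : finType) : spanning (@fbasis K B).
Proof.
move=> U f g fg u; rewrite [u]fbasis_sum !linear_sum.
by apply: eq_bigr => b _; rewrite !linearZ fg.
Qed.

Lemma line1_spanning : @spanning unit K^o (fun=> 1).
Proof.
move=> U f g fg a; rewrite -[a]mulr1 -[a * 1]/(a *: (1 : K^o)) !linearZ.
by rewrite (fg tt).
Qed.

Lemma tens_spanning I J (V W : lmodType K) (e : I -> V) (e' : J -> W) :
  spanning e -> spanning e' -> spanning (fun p => e p.1 ⊗ e' p.2).
Proof.
move=> se se' U f g fg; apply: tensor_ext => v w.
have rlin (h : {linear (V ⊗ W)%type -> U}) v0 : linear (fun w => h (v0 ⊗ w)).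
  by move=> a x y; rewrite tensDr tensZr linearP.
have llin (h : {linear (V ⊗ W)%type -> U}) w0 : linear (fun v => h (v ⊗ w0)).
  by move=> a x y; rewrite tensDl tensZl linearP.
pose l (h : {linear (V ⊗ W)%type -> U}) w0 : {linear V -> U} :=
  HB.pack (fun v => h (v ⊗ w0)) (GRing.isLinear.Build _ _ _ _ _ (llin h w0)).
pose r (h : {linear (V ⊗ W)%type -> U}) v0 : {linear W -> U} :=
  HB.pack (fun w => h (v0 ⊗ w)) (GRing.isLinear.Build _ _ _ _ _ (rlin h v0)).
apply: (se _ (l f w) (l g w)) => i /=.
apply: (se' _ (r f (e i)) (r g (e i))) => j /=.
exact: (fg (i, j)).
Qed.

End Spanning.

Lemma powBA_boolAlg (K : fieldType) (X : finType) : is_boolAlg (powBA K X).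
Proof.
pose s1 := @fbasis_spanning K {set X}; pose s2 := tens_spanning s1 s1.
pose s1' := @line1_spanning K.
have pE := (tmapE, tswapE, tassocE, tmidswapE, runitE, fextE, fext2E).
split.
- by apply: s2 => -[a b]; rewrite /= !pE setUC.
- by apply: s2 => -[a b]; rewrite /= !pE setIC.
- by apply: (tens_spanning s2 s1) => -[[a b] d];
  rewrite /= !pE /= !pE setUA.
- by apply: (tens_spanning s2 s1) => -[[a b] d];
  rewrite /= !pE /= !pE setIA.
- by apply: (tens_spanning s1 s2) => -[a [b d]];
  rewrite /= !pE /= !pE /= !pE setIUr.
- by apply: (tens_spanning s1 s2) => -[a [b d]];
  rewrite /= !pE /= !pE /= !pE setUIr.
- apply: (tens_spanning s1 s1') => -[a []] /=.
  by rewrite !pE /= /line !scale1r !pE setU0.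
- apply: (tens_spanning s1 s1') => -[a []] /=.
  by rewrite !pE /= /line !scale1r !pE setIT.
- by apply: (s1) => a; rewrite /= !pE /= !pE /line scale1r setICr.
- by apply: (s1) => a; rewrite /= !pE /= !pE /line scale1r setUCr.
- by apply: s2 => -[a b]; rewrite /= !pE /= !pE /= !pE scale1r setIC setUK.
- by apply: s2 => -[a b]; rewrite /= !pE /= !pE /= !pE scale1r setUC setIK.
- by apply: (s1) => a; rewrite /= !pE /= !pE.
- by apply: (s1) => a; rewrite /= !pE.
Qed.

(* Main.v *)
(** Every axiom of a Boolean algebra is an equality of multilinear maps.  On
    pure tensors each side of the axiom for V ⊗ W is, up to a shuffle of the
    factors, the tensor product of the corresponding sides for V and for W;
    the value of the diagonal is not a pure tensor, but both sides are linear
    in it, so that it may be replaced by one.  For the second part, a subset of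
    a disjoint union is a pair of subsets, whence
    <P(X + Y)> = <P(X)> ⊗ <P(Y)>, and one concludes by induction on |X|. *)
Require Import Defs.
From HB Require Import structures.
From mathcomp Require Import all_boot all_algebra.

Set Implicit Arguments.
Unset Strict Implicit.
Unset Printing Implicit Defensive.

Import GRing.Theory.
Local Open Scope ring_scope.

(** * Zero, scalars and bijections in tensor products *)

Section TensorLemmas.
Variable K : fieldType.
Implicit Types V W : lmodType K.

Lemma tens0l V W (w : W) : (0 : V) ⊗ w = 0.
Proof. by rewrite -[X in X ⊗ w](scale0r (0 : V)) tensZl scale0r. Qed.

Lemma tens0r V W (v : V) : v ⊗ (0 : W) = 0.
Proof. by rewrite -[X in v ⊗ X](scale0r (0 : W)) tensZr scale0r. Qed.

Lemma scalar_linearE V (f : {linear K^o -> V}) (s : K^o) : f s = s *: f 1.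
Proof. by rewrite -linearZ /= [s *: _]mulr1. Qed.

(** An arbitrary space has no chosen basis here; taking all its vectors as the spanning family lets
    [tens_spanning] reduce iterated tensor products to pure tensors. *)
Lemma id_spanning V : spanning (@id V).
Proof. by []. Qed.

Lemma tmap_id V W : tmap (@idfun V) (@idfun W) =1 id.
Proof.
by elim/tensor_ind => [|v w t IHt]; rewrite ?linear0 // linearD /= IHt tmapE.
Qed.

(** The inverses of [f] and [g] are again linear, and their tensor product is the inverse, as pure
    tensors show. *)
Lemma tmap_bij V V' W W' (f : {linear V -> V'}) (g : {linear W -> W'}) :
  bijective f -> bijective g -> bijective (tmap f g).
Proof.
move=> [f' fK f'K] [g' gK g'K].
have lf : linear f' by exact: can2_linear fK f'K.
have lg : linear g' by exact: can2_linear gK g'K.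
pose f'l : {linear V' -> V} := HB.pack f' (GRing.isLinear.Build _ _ _ _ _ lf).
pose g'l : {linear W' -> W} := HB.pack g' (GRing.isLinear.Build _ _ _ _ _ lg).
exists (tmap f'l g'l).
- apply: (@tensor_ext K V W _ (tmap f'l g'l \o tmap f g) idfun) => v w /=.
  by rewrite !tmapE /= fK gK.
- apply: (@tensor_ext K V' W' _ (tmap f g \o tmap f'l g'l) idfun) => v w /=.
  by rewrite !tmapE /= f'K g'K.
Qed.

End TensorLemmas.

(* Reduces an equation linear in the tensor t to the case of a pure tensor. *)
Ltac tensor_elim t :=
  let a := fresh "a" in let b := fresh "b" in let IH := fresh "IH" in
  elim/tensor_ind: t => [|a b t IH];
  [by rewrite /= ?(tens0l, tens0r, linear0)
  |rewrite /= ?(tensDl, tensDr, linearD) /= ?IH /= ?(tensDl, tensDr, linearD);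
   congr (_ + _); clear IH t].

Definition tensE := (tmapE, tswapE, tassocE, tmidswapE, runitE).

(** * The Boolean algebra axioms for the tensor product *)

Section TensorBoolAlg.
Variables (K : fieldType) (V W : boolStruct K).
Hypotheses (VB : is_boolAlg V) (WB : is_boolAlg W).

Let s1 := tens_spanning (@id_spanning K V) (@id_spanning K W).
Let s2 := tens_spanning s1 s1.
Let s3 := tens_spanning s2 s1.

Lemma tensorBA_boolAlg : is_boolAlg (tensorBA V W).
Proof.
split.
- apply: s2 => -[[a b] [c d]] /=; rewrite !tensE.
  by rewrite (bcupC VB) (bcupC WB) /= !tensE.
- apply: s2 => -[[a b] [c d]] /=; rewrite !tensE.
  by rewrite (bcapC VB) (bcapC WB) /= !tensE.
- apply: s3 => -[[[a b] [c d]] [u v]] /=; rewrite !tensE /= !tensE.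
  have /= := bcupA VB ((a ⊗ c) ⊗ u); rewrite !tensE /= => ->.
  by have /= := bcupA WB ((b ⊗ d) ⊗ v); rewrite !tensE /= => ->.
- apply: s3 => -[[[a b] [c d]] [u v]] /=; rewrite !tensE /= !tensE.
  have /= := bcapA VB ((a ⊗ c) ⊗ u); rewrite !tensE /= => ->.
  by have /= := bcapA WB ((b ⊗ d) ⊗ v); rewrite !tensE /= => ->.
- apply: (tens_spanning s1 s2) => -[[a b] [[c d] [u v]]] /=.
  rewrite !tensE /= !tensE /=.
  have /= := bcapUr VB (a ⊗ (c ⊗ u)); rewrite !tensE /= => ->.
  have /= := bcapUr WB (b ⊗ (d ⊗ v)); rewrite !tensE /= => ->.
  (* Both sides now depend on [a] and [b] only through their diagonals, so arbitrary tensors can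
     take the place of these. *)
  move: (bdiag a) (bdiag b) => s t.
  tensor_elim s; tensor_elim t.
  by rewrite !tensE /= !tensE /= ?tensE.
- apply: (tens_spanning s1 s2) => -[[a b] [[c d] [u v]]] /=.
  rewrite !tensE /= !tensE /=.
  have /= := bcupIr VB (a ⊗ (c ⊗ u)); rewrite !tensE /= => ->.
  have /= := bcupIr WB (b ⊗ (d ⊗ v)); rewrite !tensE /= => ->.
  move: (bdiag a) (bdiag b) => s t.
  tensor_elim s; tensor_elim t.
  by rewrite !tensE /= !tensE /= ?tensE.
- apply: (tens_spanning s1 (@line1_spanning K)) => -[[a b] []] /=.
  rewrite !tensE /= /line !scale1r !tensE.
  have /= := bcup0 VB (a ⊗ (1 : K^o)); rewrite !tensE scale1r => ->.
  by have /= := bcup0 WB (b ⊗ (1 : K^o)); rewrite !tensE scale1r => ->.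
- apply: (tens_spanning s1 (@line1_spanning K)) => -[[a b] []] /=.
  rewrite !tensE /= /line !scale1r !tensE.
  have /= := bcap1 VB (a ⊗ (1 : K^o)); rewrite !tensE scale1r => ->.
  by have /= := bcap1 WB (b ⊗ (1 : K^o)); rewrite !tensE scale1r => ->.
- apply: s1 => -[a b] /=; rewrite !tensE /= /line.
  (* The interleaved diagonals are first separated into a [V] part and a [W] part; only then does
     the axiom apply to each factor. *)
  transitivity (bcap (tmap idfun bcompl (bdiag a))
              ⊗ bcap (tmap idfun bcompl (bdiag b))).
    move: (bdiag a) (bdiag b) => s t.
    tensor_elim s; tensor_elim t.
    by rewrite !tensE /= !tensE /= ?tensE.
  have /= -> := bcapN VB a; have /= -> := bcapN WB b.
  (* Linearity pulls the two evaluations out of the tensor as scalars, whose product is the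
     evaluation on [V ⊗ W]. *)
  rewrite (scalar_linearE _ (bev a)) (scalar_linearE _ (bev b)).
  by rewrite tensZl tensZr scalerA mulrC.
- apply: s1 => -[a b] /=; rewrite !tensE /= /line.
  transitivity (bcup (tmap idfun bcompl (bdiag a))
              ⊗ bcup (tmap idfun bcompl (bdiag b))).
    move: (bdiag a) (bdiag b) => s t.
    tensor_elim s; tensor_elim t.
    by rewrite !tensE /= !tensE /= ?tensE.
  have /= -> := bcupN VB a; have /= -> := bcupN WB b.
  rewrite (scalar_linearE _ (bev a)) (scalar_linearE _ (bev b)).
  by rewrite tensZl tensZr scalerA mulrC.
- apply: s2 => -[[a b] [c d]] /=; rewrite !tensE /= !tensE /=.
  transitivity (bcap (tmap idfun bcup (tassoc (bdiag a ⊗ c)))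
              ⊗ bcap (tmap idfun bcup (tassoc (bdiag b ⊗ d)))).
    move: (bdiag a) (bdiag b) => s t.
    tensor_elim s; tensor_elim t.
    by rewrite !tensE /= !tensE /= ?tensE.
  have /= := bcapUK VB (a ⊗ c); rewrite !tensE /= => ->.
  have /= := bcapUK WB (b ⊗ d); rewrite !tensE /= => ->.
  by rewrite tensZl tensZr scalerA mulrC.
- apply: s2 => -[[a b] [c d]] /=; rewrite !tensE /= !tensE /=.
  transitivity (bcup (tmap idfun bcap (tassoc (bdiag a ⊗ c)))
              ⊗ bcup (tmap idfun bcap (tassoc (bdiag b ⊗ d)))).
    move: (bdiag a) (bdiag b) => s t.
    tensor_elim s; tensor_elim t.
    by rewrite !tensE /= !tensE /= ?tensE.
  have /= := bcupIK VB (a ⊗ c); rewrite !tensE /= => ->.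
  have /= := bcupIK WB (b ⊗ d); rewrite !tensE /= => ->.
  by rewrite tensZl tensZr scalerA mulrC.
- apply: s1 => -[a b] /=; rewrite !tensE /=.
  (* [sh] regroups three factors [V] and three factors [W] into three factors [V ⊗ W]; both iterated
     diagonals of [V ⊗ W] are images under it. *)
  pose sh (x : V ⊗ (V ⊗ V)) (y : W ⊗ (W ⊗ W)) :=
    tmap idfun tmidswap (tmidswap (x ⊗ y)).
  transitivity (sh (tassoc (tmap bdiag idfun (bdiag a)))
                   (tassoc (tmap bdiag idfun (bdiag b)))).
    rewrite /sh; move: (bdiag a) (bdiag b) => s t.
    tensor_elim s; tensor_elim t; rewrite !tensE /= !tensE /=.
    (* Once the outer diagonals are pure, the diagonals of their first components remain and are
       treated alike. *)
    move: (bdiag _) (bdiag _) => s t.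
    tensor_elim s; tensor_elim t.
    by rewrite !tensE /= !tensE /= ?tensE.
  have /= -> := bdiagA VB a; have /= -> := bdiagA WB b.
  rewrite /sh; move: (bdiag a) (bdiag b) => s t.
  tensor_elim s; tensor_elim t.
  by rewrite !tensE /= !tensE /= ?tensE.
- apply: s1 => -[a b] /=; rewrite !tensE /=.
  have /= Ea := bdiagC VB a; have /= Eb := bdiagC WB b.
  (* Cocommutativity is used on the right-hand side only; what is left holds for arbitrary
     tensors. *)
  rewrite -{2}Ea -{2}Eb; move: (bdiag a) (bdiag b) => s t.
  tensor_elim s; tensor_elim t.
  by rewrite !tensE.
Qed.

End TensorBoolAlg.

(** * Isomorphisms and the decomposition of power set algebras *)

Section BoolIso.
Variable K : fieldType.

Lemma boolIso_trans (U V W : boolStruct K) :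
  boolIso U V -> boolIso V W -> boolIso U W.
Proof.
move=> [f fbij fM] [g gbij gM]; exists (g \o f); first exact: bij_comp.
have fgE : tmap (g \o f) (g \o f) =1 tmap g g \o tmap f f.
  by apply: tensor_ext => a b /=; rewrite !tensE.
split=> x /=.
- have /= -> := bmorph_cup fM x; rewrite fgE; exact: (bmorph_cup gM).
- have /= -> := bmorph_cap fM x; rewrite fgE; exact: (bmorph_cap gM).
- have /= -> := bmorph_compl fM x; exact: (bmorph_compl gM).
- have /= -> := bmorph_top fM x; exact: (bmorph_top gM).
- have /= -> := bmorph_bot fM x; exact: (bmorph_bot gM).
- rewrite fgE /=; have /= -> := bmorph_diag fM x; exact: (bmorph_diag gM).
- by rewrite (bmorph_ev fM) /= (bmorph_ev gM).
Qed.

Lemma boolIso_tensor (V V' W W' : boolStruct K) :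
  boolIso V V' -> boolIso W W' -> boolIso (tensorBA V W) (tensorBA V' W').
Proof.
move=> [f fbij fM] [g gbij gM].
exists (tmap f g); first exact: tmap_bij.
have s1 := tens_spanning (@id_spanning K V) (@id_spanning K W).
have s2 := tens_spanning s1 s1.
have s0 := @line1_spanning K.
split.
- apply: s2 => -[[a b] [c d]] /=; rewrite !tensE /= !tensE.
  have /= := bmorph_cup fM (a ⊗ c); rewrite !tensE => ->.
  by have /= := bmorph_cup gM (b ⊗ d); rewrite !tensE => ->.
- apply: s2 => -[[a b] [c d]] /=; rewrite !tensE /= !tensE.
  have /= := bmorph_cap fM (a ⊗ c); rewrite !tensE => ->.
  by have /= := bmorph_cap gM (b ⊗ d); rewrite !tensE => ->.
- apply: s1 => -[a b] /=; rewrite !tensE.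
  by have /= -> := bmorph_compl fM a; have /= -> := bmorph_compl gM b.
- apply: s0 => -[] /=; rewrite /line !scale1r !tensE.
  by have /= -> := bmorph_top fM 1; have /= -> := bmorph_top gM 1.
- apply: s0 => -[] /=; rewrite /line !scale1r !tensE.
  by have /= -> := bmorph_bot fM 1; have /= -> := bmorph_bot gM 1.
- apply: s1 => -[a b] /=; rewrite !tensE.
  (* Read from right to left, this leaves the diagonals of [a] and [b] themselves on both sides,
     ready to be generalised. *)
  have /= <- := bmorph_diag fM a; have /= <- := bmorph_diag gM b.
  move: (bdiag a) (bdiag b) => s t.
  by tensor_elim s; tensor_elim t; rewrite !tensE /= !tensE.
- apply: s1 => -[a b] /=; rewrite !tensE.
  by rewrite (bmorph_ev fM) (bmorph_ev gM).
Qed.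

Lemma boolIso_refl (V : boolStruct K) : boolIso V V.
Proof.
exists idfun; first by exists id.
by split=> x //=; rewrite tmap_id.
Qed.

(* It suffices to find a basis of V, indexed by the subsets of X, on which the
   operations of V act as the set operations. *)
Lemma powBA_iso (X : finType) (V : boolStruct K) (e : {set X} -> V)
    (g : {linear V -> powBA K X}) :
  (forall a, g (e a) = fbasis K a) -> spanning e ->
  (forall a b, bcup (e a ⊗ e b) = e (a :|: b)) ->
  (forall a b, bcap (e a ⊗ e b) = e (a :&: b)) ->
  (forall a, bcompl (e a) = e (~: a)) ->
  btop 1 = e setT -> bbot 1 = e set0 ->
  (forall a, bdiag (e a) = e a ⊗ e a) -> (forall a, bev (e a) = 1) ->
  boolIso (powBA K X) V.
Proof.
move=> ge se eU eI eC eT e0 eD eE.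
have s1 := @fbasis_spanning K {set X}; have s2 := tens_spanning s1 s1.
have s0 := @line1_spanning K.
have pE := (tensE, fextE, fext2E).
(* The linear extension of [e] is inverse to [g], since each composite fixes a spanning family. *)
exists (fext e : {linear powBA K X -> V}).
- exists g.
  + by apply: (s1 _ (g \o fext e) idfun) => a /=; rewrite fextE ge.
  + by apply: (se _ (fext e \o g) idfun) => a /=; rewrite ge fextE.
- split.
  + by apply: s2 => -[a b] /=; rewrite !pE /= ?pE eU.
  + by apply: s2 => -[a b] /=; rewrite !pE /= ?pE eI.
  + by apply: (s1) => a /=; rewrite !pE /= ?pE eC.
  + by apply: s0 => -[] /=; rewrite /line scale1r eT !pE /= ?pE.
  + by apply: s0 => -[] /=; rewrite /line scale1r e0 !pE /= ?pE.
  + by apply: (s1) => a /=; rewrite !pE /= ?pE eD.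
  + by apply: (s1) => a /=; rewrite !pE /= ?pE eE.
Qed.

(** Enumerating both sets gives a bijection, and taking preimages under it commutes with all set
    operations. *)
Lemma powBA_card (X Y : finType) :
  #|X| = #|Y| -> boolIso (powBA K X) (powBA K Y).
Proof.
move=> XY; pose h y : X := enum_val (cast_ord (esym XY) (enum_rank y)).
pose h' x : Y := enum_val (cast_ord XY (enum_rank x)).
have hK : cancel h h'.
  by move=> y; rewrite /h /h' enum_valK cast_ordKV enum_rankK.
have h'K : cancel h' h.
  by move=> x; rewrite /h /h' enum_valK cast_ordK enum_rankK.
have pK (a : {set X}) : h' @^-1: (h @^-1: a) = a.
  by apply/setP => x; rewrite !inE h'K.
have p'K (a : {set Y}) : h @^-1: (h' @^-1: a) = a.
  by apply/setP => x; rewrite !inE hK.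
pose e (a : {set X}) : powBA K Y := fbasis K (h @^-1: a).
pose g : {linear powBA K Y -> powBA K X} :=
  fext (fun b : {set Y} => fbasis K (h' @^-1: b)).
apply: (@powBA_iso X _ e g) => /=.
- by move=> a; rewrite fextE pK.
- move=> U f f' ff'; apply: fbasis_spanning => b.
  by rewrite -[b]p'K ff'.
- by move=> a b; rewrite fext2E /e preimsetU.
- by move=> a b; rewrite fext2E /e preimsetI.
- by move=> a; rewrite fextE /e preimsetC.
- by rewrite /line scale1r /e preimsetT.
- by rewrite /line scale1r /e preimset0.
- by move=> a; rewrite fextE.
- by move=> a; rewrite fextE.
Qed.

Lemma powBA_sum (X Y : finType) :
  boolIso (powBA K (X + Y)%type) (tensorBA (powBA K X) (powBA K Y)).
Proof.
pose j (a : {set X}) (b : {set Y}) : {set X + Y} :=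
  [set z | match z with inl x => x \in a | inr y => y \in b end].
(* [e] sends a subset to the tensor of its traces on [X] and [Y]; [j] glues two traces together, and
   its bilinear extension [G] induces the inverse. *)
pose e (c : {set X + Y}) : tensorBA (powBA K X) (powBA K Y) :=
  fbasis K (inl @^-1: c) ⊗ fbasis K (inr @^-1: c).
pose G u v := fext (fun a => fext (fun b => fbasis K (j a b)) v) u.
have bG : bilinear_map G.
  split=> [v k u u'|u k v v']; first exact: fext_subproof.
  rewrite /G /fext scaler_sumr -big_split; apply: eq_bigr => b _ /=.
  by rewrite -!/(fext _ _) linearP scalerDr !scalerA mulrC.
have [g gE _] := tensor_universal bG.
apply: (@powBA_iso _ (tensorBA (powBA K X) (powBA K Y)) e g).
- move=> c; rewrite /e gE /G !fextE; congr fbasis.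
  by apply/setP => -[] z; rewrite !inE.
- move=> U f h fh; apply: (tens_spanning (@fbasis_spanning K _)
    (@fbasis_spanning K _)) => -[a b] /=.
  have := fh (j a b); rewrite /e.
  rewrite (_ : inl @^-1: _ = a); last by apply/setP => x; rewrite !inE.
  by rewrite (_ : inr @^-1: _ = b) //; apply/setP => x; rewrite !inE.
- by move=> a b; rewrite /e /= !tensE /= !fext2E !preimsetU.
- by move=> a b; rewrite /e /= !tensE /= !fext2E !preimsetI.
- by move=> a; rewrite /e /= !tensE /= !fextE !preimsetC.
- by rewrite /e /= /line !scale1r !preimsetT.
- by rewrite /e /= /line !scale1r !preimset0.
- by move=> a; rewrite /e /= !tensE /= !fextE !tensE.
- by move=> a; rewrite /e /= !tensE /= !fextE scale1r.
Qed.

(** The empty set is the only subset, so the algebra is a line, with the scalar 1 as the image of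
    its basis vector. *)
Lemma powBA_void (X : finType) : #|X| = 0%N -> boolIso (powBA K X) (unitBA K).
Proof.
move=> X0; have setE (a b : {set X}) : a = b.
  by apply/setP => x; have := card0_eq X0 x.
apply: (@powBA_iso X (unitBA K) (fun=> (1 : K^o)) (line (fbasis K set0))).
- by move=> a; rewrite /= /line scale1r; congr fbasis; exact: setE.
- by move=> U f g fg; apply: line1_spanning => _; exact: fg set0.
- by move=> a b /=; rewrite tensE scale1r.
- by move=> a b /=; rewrite tensE scale1r.
- by [].
- by [].
- by [].
- by move=> a /=; rewrite /line scale1r.
- by [].
Qed.

Lemma powBA_tpow (n : nat) (X : finType) :
  #|X| = n -> boolIso (powBA K X) (tpowBA (powBA K 'I_1) n).
Proof.
(* Exponent one is a separate case because [iterop] yields the algebra itself there, with no unit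
   factor. *)
elim: n X => [|[|n] IHn] X cX; first exact: powBA_void.
  by apply: powBA_card; rewrite card_ord.
(* One point is split off to match the leftmost factor of the tensor power. *)
apply: (@boolIso_trans _ (powBA K ('I_1 + 'I_n.+1)%type)).
  by apply: powBA_card; rewrite card_sum !card_ord cX.
apply: boolIso_trans (powBA_sum _ _) _.
by apply: boolIso_tensor (boolIso_refl _) (IHn _ _); rewrite card_ord.
Qed.

End BoolIso.

Theorem theorem1p6 (K : fieldType) (charK : [pchar K]%R =i pred0) :
  (forall V W : boolStruct K,
     is_boolAlg V -> is_boolAlg W -> is_boolAlg (tensorBA V W)) /\
  (forall X : finType,
     boolIso (powBA K X) (tpowBA (powBA K 'I_1) #|X|)).
Proof.
split=> [V W|X]; first exact: tensorBA_boolAlg.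
exact: powBA_tpow.
Qed.
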